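(* For a real number $x>0$ let $\mathsf w=\mathsf w_x\colon \mathbb Z_+\to\mathbb C$ be the weight defined by $$\mathsf w(0)=\frac{1}{\sqrt2},\quad \mathsf w(1)=\sqrt{\tfrac12+x},\quad \mathsf w(2)=\sqrt{\frac{1+3x}{1+2x}},\quad \mathsf w(n+2)=\xi_n(\mathsf w(2))\ \text{ for } n\geq 1,$$ and let $\phi\colon\mathbb Z_+\to\mathbb Z_+$ be given by $\phi(0)=0$ and $\phi(n)=n-1$ for $n\geq1$. Then there exists $\varepsilon\in(0,\infty)$ such that for every $x\in(0,\varepsilon)$, the weighted composition operator $C_{\phi,\mathsf w}$ is a bounded linear operator defined on all of $L^2(\mu)=\ell^2(\mathbb Z_+)$, it is a cyclic $2$-isometry, and its Cauchy dual $C_{\phi,\mathsf w}'$ is not subnormal.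
   Context: $\mathbb Z_+=\{0,1,2,\ldots\}$ and $\mu$ is the counting measure on the power set of $\mathbb Z_+$, so $L^2(\mu)=\ell^2(\mathbb Z_+)$ (complex Hilbert space). For $n\in\mathbb Z_+$, $\xi_n\colon[1,\infty)\to[1,\infty)$ is defined by $\xi_n(t)=\sqrt{\frac{1+(n+1)(t^2-1)}{1+n(t^2-1)}}$. (For $x>0$ one has $\mathsf w(2)>1$; moreover $\mathsf w(2)=\frac{\sqrt{\alpha_{\mathsf w}(2-\mathsf w(0)^2)-1}}{\mathsf w(1)}$ with $\alpha_{\mathsf w}=|\mathsf w(0)|^2+|\mathsf w(1)|^2$.) The weighted composition operator $C_{\phi,\mathsf w}$ in $L^2(\mu)$ has domain $\{f\in L^2(\mu)\colon \mathsf w\cdot(f\circ\phi)\in L^2(\mu)\}$ and acts by $C_{\phi,\mathsf w}f=\mathsf w\cdot(f\circ\phi)$. Let $T$ be a bounded linear operator on a complex Hilbert space $\mathcal H$. $T$ is cyclic if there is $e\in\mathcal H$ such that the linear span of $\{T^ne\}_{n=0}^\infty$ is dense in $\mathcal H$. $T$ is a $2$-isometry if $I-2T^*T+T^{*2}T^2=0$. Every $2$-isometry satisfies $\|Tf\|\geq\|f\|$ for all $f$, hence is bounded from below. If $T$ is bounded from below (equivalently left-invertible), its Cauchy dual is $T'=T(T^*T)^{-1}$. $T$ is subnormal if there are a complex Hilbert space $\mathcal K$ containing $\mathcal H$ (isometrically embedded) and a normal bounded operator $N$ on $\mathcal K$ with $Th=Nh$ for all $h\in\mathcal H$. *)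

(* Defs.v *)
From HB Require Import structures.
From mathcomp Require Import all_boot all_order all_algebra.
From mathcomp Require Import complex ring lra.
From mathcomp Require Import boolp classical_sets functions reals topology.
From mathcomp Require Import normedtype sequences.

Set Implicit Arguments.
Unset Strict Implicit.
Unset Printing Implicit Defensive.

Import Order.TTheory GRing.Theory Num.Theory.
Import numFieldNormedType.Exports.

Local Open Scope classical_set_scope.
Local Open Scope complex_scope.
(* ring_scope is opened last, so that z^* is Num.conj z *)
Local Open Scope ring_scope.

HB.mixin Record CompleteNormedModule_isHilbert (R : realType) H
    & CompleteNormedModule R[i] H := {
  dotp : {dot H for (@Num.conj R[i])};
  dotp_norm : forall f : H, dotp f f = `|f| ^+ 2
}.

#[short(type="hilbertType")]
HB.structure Definition Hilbert (R : realType) :=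
  {H of CompleteNormedModule R[i] H & CompleteNormedModule_isHilbert R H}.

Section operators.
Context {R : realType}.

Definition bounded_operator (H K : hilbertType R) (T : H -> K) : Prop :=
  linear T /\ exists M : R, forall f, `|T f| <= M%:C * `|f|.

Definition bounded_below (H K : hilbertType R) (T : H -> K) : Prop :=
  exists2 c : R, 0 < c & forall f, c%:C * `|f| <= `|T f|.

Context {H : hilbertType R}.
Implicit Types (T S A B N : H -> H) (f g e : H).

(* Every bounded T has exactly one such A; linearity and boundedness of A
   follow. Uniqueness is adjoint_unique below. *)
Definition is_adjoint T A : Prop := forall f g, dotp (T f) g = dotp f (A g).

Definition normal_operator N : Prop :=
  bounded_operator N /\
  exists2 A, is_adjoint N A & forall f, N (A f) = A (N f).

Definition two_isometry T : Prop :=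
  exists2 A, is_adjoint T A &
    forall f, f - 2%:R *: A (T f) + A (A (T (T f))) = 0.

Definition cyclic_operator T : Prop :=
  exists e, dense [set f | exists (d : nat) (a : nat -> R[i]),
                           f = \sum_(n < d) a n *: iter n T e].

(* S = T (T^* T)^{-1}: A is the adjoint of T and B the inverse of A T *)
Definition is_cauchy_dual T S : Prop :=
  bounded_below T /\
  exists A B, [/\ is_adjoint T A, cancel (A \o T) B, cancel B (A \o T)
                & forall f, S f = T (B f)].

Lemma adjoint_unique T A1 A2 :
  is_adjoint T A1 -> is_adjoint T A2 -> A1 =1 A2.
Proof.
move=> T1 T2 g; apply/eqP; rewrite -subr_eq0 -(dnorm_eq0 dotp); apply/eqP.
by rewrite linearBr /= -T1 -T2 subrr.
Qed.

Lemma cauchy_dual_unique T S1 S2 :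
  is_cauchy_dual T S1 -> is_cauchy_dual T S2 -> S1 =1 S2.
Proof.
move=> [_ [A1 [B1 [TA1 _ AB1 S1E]]]] [_ [A2 [B2 [TA2 BA2 _ S2E]]]] f.
rewrite S1E S2E -{2}(AB1 f) /= (adjoint_unique TA1 TA2).
by rewrite -[A2 (T (B1 f))]/((A2 \o T) (B1 f)) BA2.
Qed.

End operators.

(* V embeds H isometrically into K and intertwines T with N *)
Definition subnormal (R : realType) (H : hilbertType R) (T : H -> H) : Prop :=
  exists (K : hilbertType R) (V : {linear H -> K}) (N : K -> K),
    [/\ forall f, `|V f| = `|f|, normal_operator N & forall f, V (T f) = N (V f)].

Section complex_series.
Context {R : realType}.
Implicit Types (u v : nat -> R[i]) (z : R[i]) (f g : nat -> R[i]).

Definition csummable u : Prop :=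
  cvgn (series (fun n => complex.Re (u n))) /\
  cvgn (series (fun n => complex.Im (u n))).

Definition csum u : R[i] :=
  limn (series (fun n => complex.Re (u n))) +i*
  limn (series (fun n => complex.Im (u n))).

Lemma csummableP (k : R[i]) u v : csummable u -> csummable v ->
  csummable (fun n => k * u n + v n).
Proof.
case=> ur ui [vr vi]; split.
- rewrite (_ : (fun n => _) = (complex.Re k *: (fun n => complex.Re (u n)) -
    complex.Im k *: (fun n => complex.Im (u n)) + (fun n => complex.Re (v n)))).
    apply: is_cvg_seriesD => //.
    by apply: is_cvg_seriesB; exact: is_cvg_seriesZ.
  apply/funext => n; rewrite !fctE.
  by case: k (u n) (v n) => [a b] [c d] [e f].
- rewrite (_ : (fun n => _) = (complex.Re k *: (fun n => complex.Im (u n)) +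
    complex.Im k *: (fun n => complex.Re (u n)) + (fun n => complex.Im (v n)))).
    apply: is_cvg_seriesD => //.
    by apply: is_cvg_seriesD; exact: is_cvg_seriesZ.
  apply/funext => n; rewrite !fctE.
  by case: k (u n) (v n) => [a b] [c d] [e f].
Qed.

Lemma csum_linear (k : R[i]) u v : csummable u -> csummable v ->
  csum (fun n => k * u n + v n) = k * csum u + csum v.
Proof.
case=> ur ui [vr vi]; rewrite /csum.
rewrite (_ : (fun n => complex.Re (k * u n + v n)) =
  (complex.Re k *: (fun n => complex.Re (u n)) -
    complex.Im k *: (fun n => complex.Im (u n)) + (fun n => complex.Re (v n)))); last first.
  apply/funext => n; rewrite !fctE.
  by case: k (u n) (v n) => [a b] [c d] [e f].
rewrite (_ : (fun n => complex.Im (k * u n + v n)) =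
  (complex.Re k *: (fun n => complex.Im (u n)) +
    complex.Im k *: (fun n => complex.Re (u n)) + (fun n => complex.Im (v n)))); last first.
  apply/funext => n; rewrite !fctE.
  by case: k (u n) (v n) => [a b] [c d] [e f].
have urk (a : R) : cvgn (series (a *: (fun n => complex.Re (u n)))) by exact: is_cvg_seriesZ.
have uik (a : R) : cvgn (series (a *: (fun n => complex.Im (u n)))) by exact: is_cvg_seriesZ.
have lurk (a : R) : limn (series (a *: (fun n => complex.Re (u n)))) =
    a * limn (series (fun n => complex.Re (u n))) by exact: lim_seriesZ.
have luik (a : R) : limn (series (a *: (fun n => complex.Im (u n)))) =
    a * limn (series (fun n => complex.Im (u n))) by exact: lim_seriesZ.
have E1 := lim_seriesB (urk (complex.Re k)) (uik (complex.Im k)).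
have E2 := lim_seriesD (uik (complex.Re k)) (urk (complex.Im k)).
rewrite (lim_seriesD (is_cvg_seriesB (urk _) (uik _)) vr).
rewrite (lim_seriesD (is_cvg_seriesD (uik _) (urk _)) vi).
rewrite {}E1 {}E2 !lurk !luik.
by case: k.
Qed.

Lemma csummable_conj u : csummable u -> csummable (fun n => (u n)^*).
Proof.
case=> ur ui; split.
  by rewrite (_ : (fun n => _) = (fun n => complex.Re (u n)))//; apply/funext => n; case: (u n).
rewrite (_ : (fun n => _) = - (fun n => complex.Im (u n))) ?is_cvg_seriesN//.
by apply/funext => n; rewrite fctE; case: (u n).
Qed.

Lemma csum_conj u : csummable u -> csum (fun n => (u n)^*) = (csum u)^*.
Proof.
case=> ur ui; rewrite /csum /=.
rewrite (_ : (fun n => complex.Re (u n)^*) = (fun n => complex.Re (u n))); last first.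
  by apply/funext => n; case: (u n).
rewrite (_ : (fun n => complex.Im (u n)^*) = - (fun n => complex.Im (u n))) ?lim_seriesN//.
by apply/funext => n; rewrite fctE; case: (u n).
Qed.

Definition sqnorm z : R := complex.Re z ^+ 2 + complex.Im z ^+ 2.

Lemma sqnorm_ge0 z : 0 <= sqnorm z.
Proof. by rewrite addr_ge0// sqr_ge0. Qed.

Lemma sqnormE z : (sqnorm z)%:C = `|z| ^+ 2.
Proof. exact: add_Re2_Im2. Qed.

Definition square_summable f : Prop := cvgn (series (fun n => sqnorm (f n))).

Lemma square_summableZ (k : R[i]) f :
  square_summable f -> square_summable (k *: f).
Proof.
rewrite /square_summable => fs.
rewrite (_ : (fun n => _) = sqnorm k *: (fun n => sqnorm (f n))).
  exact: is_cvg_seriesZ.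
apply/funext => n; rewrite !fctE /sqnorm /GRing.scale /=.
by case: k (f n) => [a b] [c d] /=; ring.
Qed.

Lemma square_summableD f g :
  square_summable f -> square_summable g -> square_summable (f + g).
Proof.
rewrite /square_summable => fs gs.
apply: (@series_le_cvg _ _ (2 *: ((fun n => sqnorm (f n)) + (fun n => sqnorm (g n))))).
- by move=> n; exact: sqnorm_ge0.
- by move=> n; rewrite !fctE mulr_ge0// addr_ge0// sqnorm_ge0.
- move=> n; rewrite !fctE /sqnorm /GRing.scale /=.
  case: (f n) (g n) => [a b] [c d] /=.
  have := sqr_ge0 (a - c); have := sqr_ge0 (b - d); nra.
- by apply: is_cvg_seriesZ; exact: is_cvg_seriesD.
Qed.

Lemma csummable_dot f g : square_summable f -> square_summable g ->
  csummable (fun n => f n * (g n)^*).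
Proof.
move=> fs gs.
have fgs : cvgn (series ((fun n => sqnorm (f n)) + (fun n => sqnorm (g n)))).
  exact: is_cvg_seriesD.
have dom (h : nat -> R) :
    (forall n, `|h n| <= sqnorm (f n) + sqnorm (g n)) -> cvgn (series h).
  move=> hfg; apply: normed_cvg; apply: series_le_cvg fgs => n.
  - exact: normr_ge0.
  - by rewrite fctE addr_ge0// sqnorm_ge0.
  - exact: hfg.
split; apply: dom => n; rewrite /sqnorm; case: (f n) (g n) => [a b] [c d] /=;
  rewrite ler_norml.
- have := sqr_ge0 (a - c); have := sqr_ge0 (b - d).
  have := sqr_ge0 (a + c); have := sqr_ge0 (b + d).
  have := sqr_ge0 a; have := sqr_ge0 b; have := sqr_ge0 c; have := sqr_ge0 d.
  by move=> *; apply/andP; split; nra.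
- have := sqr_ge0 (a - d); have := sqr_ge0 (b - c).
  have := sqr_ge0 (a + d); have := sqr_ge0 (b + c).
  have := sqr_ge0 a; have := sqr_ge0 b; have := sqr_ge0 c; have := sqr_ge0 d.
  by move=> *; apply/andP; split; nra.
Qed.

End complex_series.

Section dot_theory.
Variables (C : numClosedFieldType) (U : lmodType C) (dot : {dot U for (@Num.conj C)}).

Lemma dot_CauchySchwarz u v : `|dot u v| ^+ 2 <= dot u u * dot v v.
Proof.
have [->|v0] := eqVneq v 0; first by rewrite !linear0r normr0 expr0n mulr0.
have vv : 0 < dot v v by rewrite dnorm_gt0.
pose w := dot v v *: u - dot u v *: v.
have : 0 <= dot w w by exact: dnorm_ge0.
have -> : dot w w = dot v v * (dot u u * dot v v - `|dot u v| ^+ 2).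
  have vvr : (dot v v)^* = dot v v.
    by have := hermC dot v v; rewrite expr0 mul1r => <-.
  have vu : dot v u = (dot u v)^* by have := hermC dot v u; rewrite expr0 mul1r.
  rewrite /w linearBl /= !linearBr /= !linearZl_LR /= !linearZr_LR /= vvr vu normCK.
  ring.
by rewrite pmulr_rge0// subr_ge0.
Qed.

Lemma dot_triangle u v :
  sqrtC (dot (u + v) (u + v)) <= sqrtC (dot u u) + sqrtC (dot v v).
Proof.
have D0 w : 0 <= dot w w by exact: dnorm_ge0.
rewrite -ler_sqr ?nnegrE ?addr_ge0 ?sqrtC_ge0// sqrrD !sqrtCK.
rewrite dnormD /= addrAC lerD2r lerD2l.
have -> : dot u v + (dot u v)^* = 'Re (dot u v) *+ 2.
  by rewrite ReE -mulr_natr divfK// pnatr_eq0.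
rewrite lerMn2r /= (le_trans (leif_Re_Creal _))//.
rewrite -sqrtCM ?nnegrE// -[leLHS]sqrCK// ler_sqrtC ?nnegrE ?exprn_ge0 ?mulr_ge0//.
exact: dot_CauchySchwarz.
Qed.

End dot_theory.


Section ell2.
Context {R : realType}.

Definition square_summable_pred : {pred nat -> R[i]} :=
  [pred f | `[< square_summable f >]].

Lemma square_summable_submod : submod_closed square_summable_pred.
Proof.
split=> [|k f g].
  suff h : square_summable (0 : nat -> R[i]) by exact/asboolT.
  rewrite /square_summable.
  rewrite (_ : (fun n => _) = (0 : nat -> R)).
    rewrite (_ : series 0 = fun=> 0).
      by apply/cvg_ex; exists 0; exact: cvg_cst.
    by apply/funext => n; rewrite /series /= big1.
  by apply/funext => n; rewrite /sqnorm /= expr0n addr0.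
move=> /asboolP fs /asboolP gs; apply/asboolT.
by apply: square_summableD => //; exact: square_summableZ.
Qed.

HB.instance Definition _ :=
  GRing.isSubmodClosed.Build R[i] (nat -> R[i]) square_summable_pred square_summable_submod.

End ell2.

Record ell2 (R : realType) := Ell2 {
  ell2_fun :> nat -> R[i];
  ell2_subproof : ell2_fun \in square_summable_pred
}.

Section ell2_instances.
Context {R : realType}.

HB.instance Definition _ := [isSub for @ell2_fun R].
HB.instance Definition _ := [Choice of ell2 R by <:].
HB.instance Definition _ := [SubChoice_isSubLmodule of ell2 R by <:].

Implicit Types (f g : ell2 R) (k : R[i]).

Lemma ell2P f : square_summable f.
Proof. by have /asboolP := ell2_subproof f. Qed.
Arguments ell2P f : clear implicits.

Lemma ell2_eqP f g : (forall n, f n = g n) -> f = g.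
Proof. by move=> fg; apply/val_inj/funext. Qed.

Lemma ell2DE f g n : (f + g) n = f n + g n. Proof. by []. Qed.
Lemma ell2ZE k f n : (k *: f) n = k * f n. Proof. by []. Qed.

Definition ell2_dot f g : R[i] := csum (fun n => f n * (g n)^*).

Let dot_linearl g : linear_for *%R (ell2_dot ^~ g).
Proof.
move=> k f1 f2; have c f : csummable (fun n => f n * (g n)^*) := csummable_dot (ell2P f) (ell2P g).
rewrite /ell2_dot /= -(csum_linear k (c f1) (c f2)).
congr csum; apply/funext => n. by rewrite mulrA -mulrDl.
Qed.

Let dot_herm f g : ell2_dot f g = (-1) ^+ false * Num.conj (ell2_dot g f).
Proof.
rewrite expr0 mul1r /ell2_dot -csum_conj; last first.
  exact: csummable_dot (ell2P _) (ell2P _).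
by congr csum; apply/funext => n; rewrite rmorphM /= conjCK mulrC.
Qed.

Let dot_linearr f : linear_for (Num.conj \; *%R) (ell2_dot f).
Proof.
move=> k g1 g2; have h u v : ell2_dot u v = (ell2_dot v u)^*.
  by have := dot_herm u v; rewrite expr0 mul1r.
rewrite (h f g1) (h f g2) h dot_linearl rmorphD rmorphM. by [].
Qed.

HB.instance Definition _ := bilinear_isBilinear.Build R[i] (ell2 R) (ell2 R) R[i]
  *%R (Num.conj \; *%R) ell2_dot (dot_linearl, dot_linearr).
HB.instance Definition _ := isHermitianSesquilinear.Build R[i] (ell2 R) false Num.conj
  ell2_dot dot_herm.

Lemma ell2_dotE f : ell2_dot f f = (limn (series (fun n => sqnorm (f n))))%:C.
Proof.
rewrite /ell2_dot /csum.
rewrite (_ : (fun n => complex.Re _) = (fun n => sqnorm (f n))); last first.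
  by apply/funext => n; rewrite /sqnorm; case: (f n) => a b /=; ring.
rewrite (_ : (fun n => complex.Im _) = 0); last first.
  by apply/funext => n; rewrite -[RHS]/(0 : R); case: (f n) => a b /=; ring.
congr (_ +i* _); rewrite (_ : series 0 = fun=> 0) ?lim_cst//.
by apply/funext => n; rewrite /series /= big1.
Qed.

Lemma ell2_sqnorm_le f n : sqnorm (f n) <= limn (series (fun n => sqnorm (f n))).
Proof.
apply: (@le_trans _ _ (series (fun n => sqnorm (f n)) n.+1)).
  rewrite seriesSr lerDr /series /= sumr_ge0// => i _; exact: sqnorm_ge0.
apply: nondecreasing_cvgn_le (ell2P f) _.
by apply: nondecreasing_series => i _ _; exact: sqnorm_ge0.
Qed.

Let dot_gt0 f : f != 0 -> 0 < ell2_dot f f.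
Proof.
move=> f0; rewrite ell2_dotE ltcR lt_neqAle; apply/andP; split; last first.
  by apply: le_trans (ell2_sqnorm_le f 0); exact: sqnorm_ge0.
apply: contra f0 => /eqP s0; apply/eqP/ell2_eqP => n.
have := ell2_sqnorm_le f n; rewrite -s0 => fn0.
apply/eqP; rewrite -normr_eq0 -sqrf_eq0 -sqnormE -[0]/(0%:C).
by apply/eqP; congr _%:C; apply/le_anti; rewrite fn0 sqnorm_ge0.
Qed.

HB.instance Definition _ := isDotProduct.Build R[i] (ell2 R) ell2_dot dot_gt0.

Definition ell2_norm f : R[i] := sqrtC (ell2_dot f f).

Let norm_triangle f g : ell2_norm (f + g) <= ell2_norm f + ell2_norm g.
Proof. exact: dot_triangle. Qed.

Let normZ k f : ell2_norm (k *: f) = `|k| * ell2_norm f.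
Proof.
have ff : 0 <= ell2_dot f f by exact: dnorm_ge0.
by rewrite /ell2_norm dnormZ sqrtCM ?nnegrE ?exprn_ge0// sqrCK.
Qed.

Let norm_eq0 f : ell2_norm f = 0 -> f = 0.
Proof. by move=> /eqP; rewrite sqrt_dnorm_eq0 => /eqP. Qed.

HB.instance Definition _ := Lmodule_isNormed.Build R[i] (ell2 R)
  norm_triangle normZ norm_eq0.

Lemma ell2_normE f : ell2_dot f f = `|f| ^+ 2.
Proof. by rewrite -[`|f|]/(ell2_norm f) sqrtCK. Qed.

End ell2_instances.
Arguments ell2P {R} f.

Section ell2_complete.
Context {R : realType}.
Implicit Types (f g : ell2 R).

Lemma ell2_norm_sqnorm f :
  `|f| ^+ 2 = (limn (series (fun n => sqnorm (f n))))%:C.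
Proof. by rewrite -ell2_normE ell2_dotE. Qed.

Lemma ell2_norm_le f (e : R) : 0 <= e ->
  (forall N, \sum_(n < N) sqnorm (f n) <= e ^+ 2) -> `|f| <= e%:C.
Proof.
move=> e0 fe; rewrite -ler_sqr ?nnegrE ?ler0c// ell2_norm_sqnorm -rmorphXn/= lecR.
apply: limr_le; first exact: (ell2P f).
by apply: nearW => N; rewrite /series /= big_mkord.
Qed.

Lemma ell2_sum_le f (e : R) N : `|f| <= e%:C -> 0 <= e ->
  \sum_(n < N) sqnorm (f n) <= e ^+ 2.
Proof.
move=> fe e0; rewrite -lecR rmorphXn /=.
have : `|f| ^+ 2 <= e%:C ^+ 2 by rewrite ler_sqr ?nnegrE ?ler0c.
apply: le_trans; rewrite ell2_norm_sqnorm lecR.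
have -> : \sum_(n < N) sqnorm (f n) = series (fun n => sqnorm (f n)) N.
  by rewrite /series /= big_mkord.
apply: nondecreasing_cvgn_le (ell2P f) _.
by apply: nondecreasing_series => i _ _; exact: sqnorm_ge0.
Qed.

Lemma ell2_complete (F : set_system (ell2 R)) :
  ProperFilter F -> cauchy F -> cvg F.
Proof.
move=> FF /cauchyP FC.
have Fex (e : R) : 0 < e -> exists f, \forall g \near F, `|f - g| < e%:C.
  move=> e0; have [f Ff] := FC e%:C (etrans (ltcR 0 e) e0).
  by exists f; move: Ff; rewrite -ball_normE.
have Fcoord (p : ell2 R -> R) : (forall f g, `|p f - p g|%:C <= `|f - g|) -> cvg (p @ F).
  move=> pP; apply: cauchy_cvg; apply: cauchy_exP => e e0.
  have [f Ff] := Fex e e0; exists (p f).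
  apply: filterS Ff => g fg /=; rewrite -ball_normE /=.
  by rewrite -ltcR (le_lt_trans (pP _ _)).
have sq_le f n : sqnorm (f n) <= complex.Re `|f| ^+ 2.
  have := ell2_sqnorm_le f n; rewrite -lecR -ell2_norm_sqnorm.
  have -> : `|f| = (complex.Re `|f|)%:C by rewrite RRe_real// ger0_real.
  by rewrite -rmorphXn /= lecR.
have nE f : `|f| = (complex.Re `|f|)%:C by rewrite RRe_real// ger0_real.
have nRe0 f : 0 <= complex.Re `|f| by rewrite -ler0c -nE.
have Fre n : cvg ((fun f : ell2 R => complex.Re (f n)) @ F).
  apply: Fcoord => f g; rewrite nE lecR.
  rewrite -(ler_pXn2r (n := 2)) ?nnegrE// real_normK ?num_real//.
  apply: le_trans (sq_le (f - g) n).
  have -> : (f - g) n = f n - g n by [].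
  by case: (f n) (g n) => [a b] [c d]; rewrite /sqnorm /= lerDl sqr_ge0.
have Fim n : cvg ((fun f : ell2 R => complex.Im (f n)) @ F).
  apply: Fcoord => f g; rewrite nE lecR.
  rewrite -(ler_pXn2r (n := 2)) ?nnegrE// real_normK ?num_real//.
  apply: le_trans (sq_le (f - g) n).
  have -> : (f - g) n = f n - g n by [].
  by case: (f n) (g n) => [a b] [c d]; rewrite /sqnorm /= lerDr sqr_ge0.
pose l n : R[i] := lim ((fun f : ell2 R => complex.Re (f n)) @ F) +i*
                   lim ((fun f : ell2 R => complex.Im (f n)) @ F).
have Fsum (h : nat -> R[i]) N :
    (\sum_(n < N) sqnorm (h n - (f : ell2 R) n)) @[f --> F] -->
    \sum_(n < N) sqnorm (h n - l n).
  elim: N => [|N IH].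
    rewrite big_ord0 (_ : (fun f => _) = fun=> 0); first exact: cvg_cst.
    by apply/funext => f; rewrite big_ord0.
  rewrite big_ord_recr /= (_ : (fun f => _) = (fun f : ell2 R =>
      \sum_(n < N) sqnorm (h n - f n) + sqnorm (h N - f N))); last first.
    by apply/funext => f; rewrite big_ord_recr.
  apply: cvgD => //.
  rewrite /sqnorm !raddfB /=.
  rewrite (_ : (fun f => _) = (fun f : ell2 R =>
     (complex.Re (h N) - complex.Re (f N)) * (complex.Re (h N) - complex.Re (f N)) +
     (complex.Im (h N) - complex.Im (f N)) * (complex.Im (h N) - complex.Im (f N)))); last first.
    by apply/funext => f; rewrite !raddfB /= !expr2.
  have cr : complex.Re (h N) - complex.Re (f N) @[f --> F] -->
      complex.Re (h N) - lim ((fun f : ell2 R => complex.Re (f N)) @ F).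
    by apply: cvgB; [exact: cvg_cst | exact: Fre].
  have ci : complex.Im (h N) - complex.Im (f N) @[f --> F] -->
      complex.Im (h N) - lim ((fun f : ell2 R => complex.Im (f N)) @ F).
    by apply: cvgB; [exact: cvg_cst | exact: Fim].
  by rewrite !expr2; apply: cvgD; apply: cvgM.
have lP (e : R) f : 0 < e -> (\forall g \near F, `|f - g| < e%:C) ->
    forall N, \sum_(n < N) sqnorm (f n - l n) <= e ^+ 2.
  move=> e0 fF N.
  apply: (closed_cvg (fun x : R => x <= e ^+ 2) _ _ _ (Fsum f N)).
    exact: closed_le.
  apply: filterS fF => g /ltW fg; apply: (@ell2_sum_le (f - g)) => //.
  exact: ltW.
have dP (e : R) f : 0 < e -> (\forall g \near F, `|f - g| < e%:C) ->
    square_summable (fun n => f n - l n).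
  move=> e0 fF; apply: nondecreasing_is_cvgn.
    by apply: nondecreasing_series => i _ _; exact: sqnorm_ge0.
  exists (e ^+ 2) => _ [N _ <-]; rewrite /series /= big_mkord.
  exact: lP.
have ls : square_summable l.
  have [f Ff] := Fex 1 ltr01.
  have sd : square_summable (fun n => f n - l n) by exact: dP Ff.
  have := square_summableD (ell2P f) (square_summableZ (k := -1) sd).
  congr square_summable; apply/funext => n.
  rewrite -[LHS]/(f n + (-1) * (f n - l n)).
  by rewrite mulN1r opprB addrC subrK.
pose L := Ell2 (asboolT ls : l \in square_summable_pred).
apply/cvg_ex; exists L; apply/cvgrPdist_lt => eps eps0.
have epsE : eps = (complex.Re eps)%:C by rewrite RRe_real// gtr0_real.
have e0 : 0 < complex.Re eps / 2 by rewrite divr_gt0// -ltcR -epsE.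
have [f Ff] := Fex _ e0.
have fL : `|f - L| <= (complex.Re eps / 2)%:C.
  by apply: ell2_norm_le; [exact: ltW | exact: lP].
apply: filterS Ff => g fg.
rewrite epsE (splitr (complex.Re eps)) rmorphD /=.
rewrite -(subrK f L) -addrA (le_lt_trans (ler_normD _ _))//.
by rewrite ler_ltD// distrC.
Qed.

HB.instance Definition _ := Uniform_isComplete.Build (ell2 R) ell2_complete.

HB.instance Definition _ :=
  CompleteNormedModule_isHilbert.Build R (ell2 R) (@ell2_normE R).

End ell2_complete.

Section weighted_composition.
Context {R : realType}.
Implicit Types (phi : nat -> nat) (w : nat -> R[i]).

Definition wcomp_fun phi w (f : nat -> R[i]) : nat -> R[i] :=
  fun n => w n * f (phi n).

Definition wcomp_dom phi w : set (ell2 R) :=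
  [set f : ell2 R | square_summable (wcomp_fun phi w f)].

(* junk value 0 outside wcomp_dom phi w *)
Definition wcomp phi w (f : ell2 R) : ell2 R := insubd 0 (wcomp_fun phi w f).

Lemma wcompE phi w (f : ell2 R) n :
  wcomp_dom phi w f -> wcomp phi w f n = w n * f (phi n).
Proof. by move=> /asboolT fd; rewrite -[LHS]/(val (wcomp phi w f) n) insubdK. Qed.

Definition xi (n : nat) (t : R) : R :=
  Num.sqrt ((1 + n.+1%:R * (t ^+ 2 - 1)) / (1 + n%:R * (t ^+ 2 - 1))).

Definition weight (x : R) (n : nat) : R[i] :=
  let w2 := Num.sqrt ((1 + 3 * x) / (1 + 2 * x)) in
  (match n with
   | 0 => 1 / Num.sqrt 2
   | 1 => Num.sqrt (1 / 2 + x)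
   | 2 => w2
   | m.+2 => xi m w2
   end)%:C.

End weighted_composition.

(* Main.v *)
Require Import Defs.
From HB Require Import structures.
From mathcomp Require Import all_boot all_order all_algebra.
From mathcomp Require Import complex ring lra.
From mathcomp Require Import boolp classical_sets functions reals topology.
From mathcomp Require Import normedtype sequences.

Set Implicit Arguments.
Unset Strict Implicit.
Unset Printing Implicit Defensive.

Import Order.TTheory GRing.Theory Num.Theory.
Import numFieldNormedType.Exports.

Local Open Scope classical_set_scope.
Local Open Scope ring_scope.

(** Write [C] for the operator, [e_n] for the unit vectors and
    [d_n = 1 + n * x]. On coordinates [C^* C] is multiplication by the mass
    that [|w| ^+ 2] puts on the fibres of [predn] ([fibre_mass]). For the given
    weights this mass is [d_1] at 0 and [d_(n+2) / d_(n+1)] at [n >= 1], so it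
    lies between 1 and [1 + x]. This gives boundedness and left invertibility; the
    equation of a 2-isometry is one scalar identity per coordinate, relating
    successive terms of this sequence and, at 0, the two weights [w 0] and
    [w 1]. Cyclicity holds
    because [C e_0] has a nonzero component on [e_1] and [C] moves [e_n] to a
    nonzero multiple of [e_(n+1)] for [n >= 1]: the orbit of [e_0] spans all
    finitely supported vectors.

    The Cauchy dual [C'] is again a weighted composition operator for [predn],
    with weights [w n / fibre_mass w n.-1]. Let [m_n = |C'^n e_0| ^+ 2]. Since
    [C'^n e_0] is supported on [0, n] and [C'^n e_1] is a multiple of
    [e_(n+1)], Pythagoras gives ([wcomp_predn_moments])
      [m_(n+1) = q * m_n + k / (c + n)],
    with [q = 1 / (2 * (1 + x) ^+ 2)], [c = (1 + 2 * x) / x] and [k > 0].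
    If [C'] were subnormal, [m] would be the sequence of moments of a positive
    measure on the half-line; the recursion says that multiplying this measure by
    [t - q] gives [k * t ^ (c - 1) dt] on [0, 1], which is positive also on
    [0, q]: impossible.

    This contradiction is carried out without measures, by testing against powers
    of [1 - t]. Put [a_n = \int (1 - t)^n], which is the [n]-th iterated
    difference of [m] at 0. For even [n] it is a squared norm, with [t] replaced
    by [N^* N] for a normal extension [N], hence nonnegative
    ([subnormal_bdiff_ge0]). The recursion reads
    [(1 - q) * a_n - a_(n+1) = b_n] with [b_n] a positive beta integral, which
    decays only polynomially in [n]. Thus [a_n / (1 - q)^n] decreases by steps
    that grow from some point on, and becomes negative ([bdiff_even_neg]). *)

(** * Iterated differences of a sequence *)

Section differences.
Context {R : realType}.
Implicit Types (m : nat -> R) (q k c : R).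

Definition bdiff m (j : nat) : R := m j - m j.+1.

Lemma iter_bdiff_shift n m j :
  iter n bdiff m j.+1 = iter n bdiff m j - iter n.+1 bdiff m j.
Proof. by rewrite [iter n.+1 _ _]iterS /bdiff opprB addrC subrK. Qed.

(** The left-hand side is [k] times the beta integral of
    [t ^ (c + j - 1) * (1 - t) ^ n] over the unit interval. *)
Lemma iter_bdiff_inv n k c j : 0 < c ->
  iter n bdiff (fun i => k / (c + i%:R)) j =
  k * n`!%:R / \prod_(i < n.+1) (c + (j + i)%:R).
Proof.
move=> c0; have cn0 i : c + i%:R != 0 by rewrite lt0r_neq0// ltr_wpDr.
have pn0 l i : \prod_(s < i) (c + (l + s)%:R) != 0.
  by apply/prodf_neq0 => s _; exact: cn0.
elim: n j => [|n IH] j.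
  by rewrite /= big_ord_recl big_ord0 addn0 mulr1 mulr1.
rewrite iterS /bdiff !IH.
pose M := \prod_(i < n) (c + (j.+1 + i)%:R).
have M0 : M != 0 by exact: pn0.
have tailE : \prod_(i < n.+1) (c + (j.+1 + i)%:R) = M * (c + (j + n.+1)%:R).
  by rewrite big_ord_recr /= addSnnS.
have headE l : \prod_(i < l.+1) (c + (j + i)%:R) =
    (c + j%:R) * \prod_(i < l) (c + (j.+1 + i)%:R).
  rewrite big_ord_recl addn0; congr (_ * _).
  by apply: eq_bigr => i _; rewrite addSnnS.
rewrite !headE // tailE -/M factS natrM.
have := cn0 j; have := cn0 (j + n.+1)%N.
rewrite natrD -natr1 => h1 h2; field.
by rewrite M0 h1 h2.
Qed.

(** As [a n.+1 = (1 - q) * a n - b n], the quotient [a n / (1 - q) ^+ n] loses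
    [r n = b n / (1 - q) ^+ n.+1] at each step. The ratio of consecutive [b] is
    [n.+1 / (c + n.+1)], which tends to 1 and so exceeds [1 - q] from some [N]
    on; from there [r] is nondecreasing and the quotient falls at least
    linearly. *)
Lemma bdiff_even_neg m q k c : 0 < q < 1 -> 0 < k -> 0 < c ->
  (forall j, m j.+1 = q * m j + k / (c + j%:R)) ->
  exists n, iter n.*2 bdiff m 0 < 0.
Proof.
move=> /andP[q0 q1] k0 c0 mS; apply: contrapT => /forallNP /= neg.
have even_ge0 n : 0 <= iter n.*2 bdiff m 0 by rewrite leNgt; apply/negP/neg.
pose a n := iter n bdiff m 0%N.
pose b n := iter n bdiff (fun i => k / (c + i%:R)) 0%N.
have bE n : b n = k * n`!%:R / \prod_(i < n.+1) (c + i%:R).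
  by rewrite /b iter_bdiff_inv.
have b_gt0 n : 0 < b n.
  rewrite bE divr_gt0 ?mulr_gt0 ?ltr0n ?fact_gt0//.
  by apply: prodr_gt0 => i _; rewrite ltr_wpDr.
have ab n : (1 - q) * a n - a n.+1 = b n.
  suff H j : iter n bdiff m j.+1 - q * iter n bdiff m j =
             iter n bdiff (fun i => k / (c + i%:R)) j.
    by rewrite /b -(H 0%N) iter_bdiff_shift /a; ring.
  elim: n j => [|n IH] j; first by rewrite /= mS; ring.
  by rewrite !iterS /bdiff -!IH; ring.
(* Odd differences inherit nonnegativity from the next even one. *)
have a_ge0 n : 0 <= a n.
  have [o|e] := boolP (odd n); last by rewrite -[n](even_halfK e) even_ge0.
  have aS : 0 <= a n.+1 by rewrite -[n.+1](@even_halfK n.+1)/= ?negbK//; exact: even_ge0.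
  rewrite -(@pmulr_rge0 _ (1 - q)) ?subr_gt0//.
  by have := ab n; have := b_gt0 n; lra.
have r0 : 0 < 1 - q by rewrite subr_gt0.
pose r n := b n / (1 - q) ^+ n.+1.
have r_gt0 n : 0 < r n by rewrite divr_gt0// exprn_gt0.
have rE n : a n.+1 / (1 - q) ^+ n.+1 = a n / (1 - q) ^+ n - r n.
  rewrite /r -ab exprS; field.
  by rewrite expf_neq0 !(lt0r_neq0 r0).
have [N qN] : exists N : nat, (1 - q) * c <= q * N%:R.
  exists (Num.truncn ((1 - q) * c / q)).+1.
  rewrite -ler_pdivrMl// mulrC ltW//.
  exact: truncnS_gt.
have r_homo n : (N <= n)%N -> r N <= r n.
  elim: n => [|n IH]; first by rewrite leqn0 => /eqP ->.
  rewrite leq_eqVlt => /predU1P[->//|]; rewrite ltnS => Nn.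
  apply: le_trans (IH Nn) _.
  have -> : r n.+1 = r n * ((n.+1%:R / (c + n.+1%:R)) / (1 - q)).
    rewrite /r !bE big_ord_recr /= factS natrM [in LHS]exprS.
    have p0 : \prod_(i < n.+1) (c + i%:R) != 0.
      by apply/prodf_neq0 => i _; rewrite lt0r_neq0// ltr_wpDr.
    field.
    by rewrite p0 expf_neq0 (lt0r_neq0 r0)//= lt0r_neq0// addr_gt0// nat1r.
  rewrite ler_peMr ?(ltW (r_gt0 n))//.
  rewrite ler_pdivlMr// mul1r ler_pdivlMr ?ltr_wpDr//.
  have : (N%:R : R) <= n.+1%:R by rewrite ler_nat ltnW.
  nra.
have a_le i : a (N + i)%N / (1 - q) ^+ (N + i) <= a N / (1 - q) ^+ N - i%:R * r N.
  elim: i => [|i IH]; first by rewrite addn0 mul0r subr0.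
  rewrite addnS rE -natr1; have := r_homo (N + i)%N (leq_addr _ _).
  lra.
pose i := (Num.truncn (a N / (1 - q) ^+ N / r N)).+1.
have : a N / (1 - q) ^+ N < i%:R * r N.
  by rewrite -ltr_pdivrMr//; exact: truncnS_gt.
have := a_le i; have : 0 <= a (N + i)%N / (1 - q) ^+ (N + i).
  by rewrite divr_ge0 ?exprn_ge0// ltW.
lra.
Qed.

End differences.

(** * A necessary condition for subnormality *)

Section subnormality.
Context {R : realType}.

Lemma dotp_conj (H : hilbertType R) (f g : H) : dotp f g = (dotp g f)^*%C.
Proof. by have := hermC (@dotp R H) f g; rewrite expr0 mul1r. Qed.

(** For a normal extension [N] with adjoint [A], put [P = A N] and [Q = 1 - P].
    Normality gives [dotp (P^j v) v = |N^j v| ^+ 2], so the [i]-th difference of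
    [m] at [j] is [dotp (P^j v) (Q^i v)]; for [i] even and [j = 0] it is
    a squared norm because [Q] is self-adjoint. *)
Lemma subnormal_bdiff_ge0 (H : hilbertType R) (T : H -> H) (f : H) (m : nat -> R) :
  subnormal T -> (forall j, `|iter j T f| ^+ 2 = (m j)%:C%C) ->
  forall n, 0 <= iter n.*2 bdiff m 0.
Proof.
move=> [K [V [N [Viso [_ [A NA ANC]] VTN]]]] mE n.
pose v := V f; pose P (g : K) := A (N g); pose Q (g : K) := g - P g.
have PE g h : dotp (P g) h = dotp (N g) (N h).
  by rewrite dotp_conj -NA -dotp_conj.
have Qsa g h : dotp (Q g) h = dotp g (Q h).
  by rewrite /Q linearBl linearBr /= PE NA.
have VN j : V (iter j T f) = iter j N v.
  by elim: j => //= j IH; rewrite VTN IH.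
have NAj j g : N (iter j A g) = iter j A (N g).
  by elim: j => //= j IH; rewrite ANC IH.
have Pj j : iter j P v = iter j A (iter j N v).
  by elim: j => //= j ->; rewrite /P NAj.
have Aj j g h : dotp (iter j A g) h = dotp g (iter j N h).
  elim: j h => // j IH h.
  by rewrite iterS dotp_conj -NA -dotp_conj IH -iterSr.
have PQ i j : dotp (iter j P v) (iter i Q v) = (iter i bdiff m j)%:C%C.
  elim: i j => [|i IH] j.
    by rewrite /= Pj Aj dotp_norm -VN Viso mE.
  rewrite iterS {1}/Q linearBr /= -NA -PE IH -[P (iter j P v)]iterS IH.
  by rewrite -rmorphB.
have Qi i g h : dotp (iter i Q g) h = dotp g (iter i Q h).
  elim: i h => // i IH h.
  by rewrite iterS Qsa IH -iterSr.
rewrite -ler0c -(PQ _ 0%N) /= -addnn iterD -Qi.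
exact: dnorm_ge0.
Qed.

End subnormality.

(** * Coordinates in the sequence space *)

Section ell2_facts.
Context {R : realType}.
Implicit Types (f g : ell2 R) (u : nat -> R[i]) (a b : R[i]).

Lemma sqnormM a b : sqnorm (a * b) = sqnorm a * sqnorm b.
Proof. by case: a b => [p q] [r s]; rewrite /sqnorm /=; ring. Qed.

Lemma sqnorm_real (r : R) : sqnorm r%:C%C = r ^+ 2.
Proof. by rewrite /sqnorm /= expr0n addr0. Qed.

Lemma square_summable_bounded u (M : R) :
  (forall N, \sum_(n < N) sqnorm (u n) <= M) -> square_summable u.
Proof.
move=> uM; apply: nondecreasing_is_cvgn.
  by apply: nondecreasing_series => i _ _; exact: sqnorm_ge0.
by exists M => _ [N _ <-]; rewrite /series /= big_mkord.
Qed.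

Lemma ell2_normR f : `|f| = (complex.Re `|f|)%:C%C.
Proof. by rewrite complex.RRe_real// ger0_real. Qed.

Lemma ell2_Renorm_ge0 f : 0 <= complex.Re `|f|.
Proof. by rewrite -ler0c -ell2_normR. Qed.

Lemma ell2_sum_sqnorm_le f N :
  \sum_(n < N) sqnorm (f n) <= complex.Re `|f| ^+ 2.
Proof. by apply: ell2_sum_le; rewrite ?ell2_Renorm_ge0// -ell2_normR. Qed.

Lemma ell2_basis_subproof (k : nat) :
  (fun n => (n == k)%:R : R[i]) \in square_summable_pred.
Proof.
apply/asboolT/(@square_summable_bounded _ 1) => N.
have E (n : nat) : sqnorm ((n == k)%:R : R[i]) = (n == k)%:R.
  by rewrite /sqnorm; case: eqP => _ /=; rewrite ?expr1n ?expr0n ?addr0.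
rewrite (_ : \sum_(n < N) _ = (k < N)%:R) ?lern1 ?leq_b1//.
elim: N => [|N IH]; first by rewrite big_ord0.
rewrite big_ord_recr /= IH E ltnS (leq_eqVlt k N) [k == N]eq_sym.
by case: eqP => [->|_]; rewrite ?ltnn ?add0r ?addr0.
Qed.

Definition basis (k : nat) : ell2 R := Ell2 (ell2_basis_subproof k).

Lemma basisE k n : basis k n = (n == k)%:R.
Proof. by []. Qed.

Lemma lim_series_single (u : nat -> R) k :
  (forall n, n != k -> u n = 0) -> limn (series u) = u k.
Proof.
move=> u0; apply/cvg_lim => //; apply: cvg_near_cst.
exists k.+1 => // N /= kN; rewrite /series /= big_mkord.
by rewrite (bigD1 (Ordinal kN))//= big1 ?addr0// => i ik; exact: u0.
Qed.

Lemma ell2_dot_basis f k : dotp f (basis k) = f k.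
Proof.
rewrite -[LHS]/(csum _) /csum.
have z n : n != k -> f n * (basis k n)^* = 0.
  by rewrite basisE => /negPf ->; rewrite conjC0 mulr0.
rewrite !(@lim_series_single _ k) => [|n /z -> //|n /z -> //].
by rewrite /= eqxx conjC1 mulr1; case: (f k).
Qed.

Lemma ell2_norm_basis k : `|basis k| = 1.
Proof.
by apply/eqP; rewrite -(@pexpr_eq1 _ _ 2)// -dotp_norm ell2_dot_basis basisE eqxx.
Qed.

Lemma ell2_pythagoras f k a b : f k = 0 ->
  `|a *: f + b *: basis k| ^+ 2 = `|a| ^+ 2 * `|f| ^+ 2 + `|b| ^+ 2.
Proof.
move=> fk; have cross : dotp (a *: f) (b *: basis k) = 0.
  rewrite linearZr_LR /= -[ell2_dot _ _]/(dotp (a *: f) (basis k)).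
  by rewrite ell2_dot_basis ell2ZE fk !mulr0.
rewrite -!dotp_norm dnormD cross conjC0 !addr0 !dnormZ.
by rewrite [dotp (basis k) _]dotp_norm ell2_norm_basis expr1n mulr1.
Qed.

(** The truncation error is a tail of the convergent series of squared
    moduli. *)
Lemma ell2_finite_approx f (e : R) : 0 < e ->
  exists N, `|f - \sum_(n < N) f n *: basis n| < e%:C%C.
Proof.
move=> e0; pose L := limn (series (fun n => sqnorm (f n))).
have e2 : 0 < e / 2 by rewrite divr_gt0.
have /cvgrPdist_le/(_ _ (exprn_gt0 2 e2)) [N _ NL] := ell2P f.
exists N; set t := \sum_(n < N) _.
have tE n : t n = if (n < N)%N then f n else 0.
  have -> : t n = \sum_(i < N) f i * (n == i)%:R.
    rewrite /t; elim: (N) => [|M IH]; first by rewrite !big_ord0.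
    by rewrite !big_ord_recr ell2DE IH ell2ZE.
  case: ltnP => nN.
    rewrite (bigD1 (Ordinal nN))//= eqxx mulr1 big1 ?addr0// => i /negPf.
    by rewrite -val_eqE /= eq_sym => ->; rewrite mulr0.
  by rewrite big1// => i _; rewrite gtn_eqF ?mulr0// (leq_trans _ nN).
have ftE n : (f - t) n = f n - t n by [].
apply: (@le_lt_trans _ _ (e / 2)%:C%C); last by rewrite ltcR; lra.
apply: ell2_norm_le => [|M]; first exact: ltW.
have NM : (N <= N + M)%N by rewrite leq_addr.
have splitE (F : nat -> R) :
    \sum_(n < N + M) F n = \sum_(n < N) F n + \sum_(n < M) F (N + n)%N.
  by rewrite big_split_ord.
have sE k : series (fun n => sqnorm (f n)) k = \sum_(n < k) sqnorm (f n).
  by rewrite /series /= big_mkord.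
apply: (@le_trans _ _ (\sum_(n < N + M) sqnorm ((f - t) n))).
  by rewrite addnC big_split_ord /= lerDl sumr_ge0// => i _; exact: sqnorm_ge0.
rewrite (splitE (fun n => sqnorm ((f - t) n))) big1 ?add0r => [|i _]; last first.
  by rewrite ftE tE ltn_ord subrr /sqnorm /= expr0n addr0.
have H : L - series (fun n => sqnorm (f n)) N <= (e / 2) ^+ 2.
  by apply: le_trans (NL N (leqnn N)); exact: ler_norm.
apply: le_trans H; rewrite lerBrDl.
apply: le_trans (_ : series (fun n => sqnorm (f n)) (N + M)%N <= _).
  rewrite !sE (splitE (fun n => sqnorm (f n))) lerD2l; apply: ler_sum => i _.
  by rewrite ftE tE ltnNge leq_addr subr0.
apply: nondecreasing_cvgn_le (ell2P f) _.
by apply: nondecreasing_series => i _ _; exact: sqnorm_ge0.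
Qed.

End ell2_facts.

(** * Weighted composition operators for the predecessor map *)

Section predn_weights.
Context {R : realType}.
Implicit Types (f g : ell2 R) (w : nat -> R[i]) (M : R).

Lemma wcomp_linear phi w : wcomp_dom phi w = setT -> linear (@wcomp R phi w).
Proof.
move=> wT k f g; apply: ell2_eqP => n.
have wE h : wcomp phi w h n = w n * h (phi n) by apply: wcompE; rewrite wT.
by rewrite ell2DE ell2ZE !wE ell2DE ell2ZE; ring.
Qed.

Lemma wcomp_dom_le phi w M : (forall n, sqnorm (w n) <= M) ->
  (forall f, square_summable (f \o phi)) -> wcomp_dom phi w = setT.
Proof.
move=> wM phiS; apply/seteqP; split=> // f _.
have M0 : 0 <= M by exact: le_trans (sqnorm_ge0 (w 0%N)) (wM 0%N).
apply: (@series_le_cvg _ _ (M *: (fun n => sqnorm (f (phi n))))).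
- by move=> n; exact: sqnorm_ge0.
- by move=> n; rewrite !fctE mulr_ge0// sqnorm_ge0.
- by move=> n; rewrite !fctE /wcomp_fun sqnormM ler_wpM2r// sqnorm_ge0.
- by apply: is_cvg_seriesZ; exact: phiS.
Qed.

(** The Radon-Nikodym derivative with respect to counting measure of the image
    under [predn] of the measure with density [|w| ^+ 2]: the fibre of [predn]
    over 0 is [{0, 1}], over [n >= 1] it is [{n + 1}]. *)
Definition fibre_mass w (n : nat) : R :=
  if n is 0 then sqnorm (w 0%N) + sqnorm (w 1%N) else sqnorm (w n.+1).

#[local] Arguments fibre_mass : simpl never.

(** The change of variables formula, on initial segments; every norm estimate
    below comes from it. *)
Lemma sum_sqnorm_wcomp_predn w f N :
  \sum_(n < N.+2) sqnorm (wcomp_fun predn w f n) =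
  \sum_(n < N.+1) fibre_mass w n * sqnorm (f n).
Proof.
elim: N => [|N IH]; last by rewrite big_ord_recr IH [RHS]big_ord_recr /= sqnormM.
by rewrite !big_ord_recr !big_ord0 /= !add0r !sqnormM [RHS]mulrDl.
Qed.

Lemma wcomp_predn_sum_le w M f N : (forall n, fibre_mass w n <= M) ->
  \sum_(n < N) sqnorm (wcomp_fun predn w f n) <= M * complex.Re `|f| ^+ 2.
Proof.
move=> wM; apply: (@le_trans _ _ (\sum_(n < N.+2) sqnorm (wcomp_fun predn w f n))).
  by rewrite !big_ord_recr /= -addrA lerDl addr_ge0 ?sqnorm_ge0.
have mass0_ge0 : 0 <= fibre_mass w 0%N by rewrite addr_ge0 ?sqnorm_ge0.
rewrite sum_sqnorm_wcomp_predn.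
apply: (@le_trans _ _ (M * \sum_(n < N.+1) sqnorm (f n))).
  by rewrite mulr_sumr; apply: ler_sum => n _; rewrite ler_wpM2r ?sqnorm_ge0.
by rewrite ler_wpM2l ?ell2_sum_sqnorm_le// (le_trans mass0_ge0).
Qed.

Lemma wcomp_predn_dom w M : (forall n, fibre_mass w n <= M) -> wcomp_dom predn w = setT.
Proof.
move=> wM; apply/seteqP; split=> // f _; rewrite /wcomp_dom /=.
apply: square_summable_bounded => N; exact: wcomp_predn_sum_le.
Qed.

Lemma wcomp_prednE w M f n : (forall n, fibre_mass w n <= M) ->
  wcomp predn w f n = w n * f n.-1.
Proof. by move=> wM; apply: wcompE; rewrite (wcomp_predn_dom wM). Qed.

Lemma wcomp_predn_bounded w M : (forall n, fibre_mass w n <= M) ->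
  bounded_operator (wcomp predn w).
Proof.
move=> wM; split; first by apply: wcomp_linear; exact: wcomp_predn_dom wM.
have M0 : 0 <= M by apply: le_trans (wM 0%N); rewrite addr_ge0 ?sqnorm_ge0.
exists (Num.sqrt M) => f; rewrite (ell2_normR f) -rmorphM.
apply: ell2_norm_le => [|N].
  by rewrite mulr_ge0 ?sqrtr_ge0 ?ell2_Renorm_ge0.
rewrite exprMn sqr_sqrtr//.
rewrite (eq_bigr (fun n : 'I_N => sqnorm (wcomp_fun predn w f n))) => [|n _].
  exact: wcomp_predn_sum_le.
by rewrite (wcomp_prednE _ _ wM).
Qed.

Lemma wcomp_predn_expansive w M : (forall n, 1 <= fibre_mass w n <= M) ->
  bounded_below (wcomp predn w).
Proof.
move=> w1M; have wM n : fibre_mass w n <= M by have /andP[] := w1M n.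
exists 1 => // f; rewrite mul1r [leRHS]ell2_normR.
apply: ell2_norm_le => [|N]; first exact: ell2_Renorm_ge0.
apply: le_trans (ell2_sum_sqnorm_le _ N.+2).
rewrite (eq_bigr (fun n : 'I_N.+2 => sqnorm (wcomp_fun predn w f n))) => [|n _]; last first.
  by rewrite (wcomp_prednE _ _ wM).
rewrite sum_sqnorm_wcomp_predn big_ord_recr /=.
rewrite -[leLHS]addr0 lerD//; last first.
  by rewrite mulr_ge0 ?sqnorm_ge0// (le_trans ler01)//; have /andP[] := w1M N.
by apply: ler_sum => n _; rewrite ler_peMl ?sqnorm_ge0//; have /andP[] := w1M n.
Qed.

(** The adjoint sums [(w m)^* * g m] over each fibre of [predn]; the last term is
    the contribution of the fixed point 0. *)
Definition wcomp_predn_adj w g : ell2 R :=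
  wcomp succn (fun n => (w n.+1)^*) g + ((w 0%N)^* * g 0%N) *: basis 0.

#[local] Arguments wcomp_predn_adj : simpl never.

Lemma sqnorm_le_fibre_mass w n : sqnorm (w n) <= fibre_mass w n.-1.
Proof. by case: n => [|[|n]] //=; rewrite ?lerDl ?lerDr sqnorm_ge0. Qed.

Lemma wcomp_predn_adjE w M g n : (forall n, fibre_mass w n <= M) ->
  wcomp_predn_adj w g n =
  (w n.+1)^* * g n.+1 + (n == 0%N)%:R * ((w 0%N)^* * g 0%N).
Proof.
move=> wM; rewrite ell2DE ell2ZE basisE wcompE ?[_%:R * _]mulrC//.
rewrite (@wcomp_dom_le _ _ M)// => [{}n|h].
  have -> : sqnorm (w n.+1)^* = sqnorm (w n.+1).
    by case: (w n.+1) => a b; rewrite /sqnorm /= sqrrN.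
  by apply: le_trans (wM n); exact: (sqnorm_le_fibre_mass w n.+1).
apply: (@square_summable_bounded _ _ (complex.Re `|h| ^+ 2)) => N.
apply: le_trans (ell2_sum_sqnorm_le h N.+1).
by rewrite big_ord_recl lerDr sqnorm_ge0.
Qed.

(** Summing over fibres: the first two terms of [u] are merged into one. *)
Lemma lim_series_merge (u v : nat -> R) : v 0%N = u 0%N + u 1%N ->
  (forall n, v n.+1 = u n.+2) -> cvgn (series u) -> limn (series u) = limn (series v).
Proof.
move=> v0 vS cu.
have E : (fun n => series u (n + 2)%N) = (fun n => series v (n + 1)%N).
  apply/funext => n; rewrite addn1 addn2 /series /= !big_mkord.
  elim: n => [|n IH]; last by rewrite big_ord_recr IH [RHS]big_ord_recr /= vS.
  by rewrite !big_ord_recr !big_ord0 /= !add0r v0.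
have lu : series u @ \oo --> limn (series u) by [].
apply/esym/cvg_lim => //; rewrite -(cvg_shiftn 1) /= -E.
by rewrite (cvg_shiftn 2 (series u)).
Qed.

Lemma wcomp_predn_is_adjoint w M : (forall n, fibre_mass w n <= M) ->
  is_adjoint (wcomp predn w) (wcomp_predn_adj w).
Proof.
move=> wM f g; rewrite -[LHS]/(csum _) -[RHS]/(csum _) /csum.
have [cr ci] := csummable_dot (ell2P (wcomp predn w f)) (ell2P g).
have E0 : f 0%N * (wcomp_predn_adj w g 0%N)^* =
    wcomp predn w f 0%N * (g 0%N)^* + wcomp predn w f 1%N * (g 1%N)^*.
  rewrite (wcomp_predn_adjE _ _ wM) !(wcomp_prednE _ _ wM) eqxx mul1r.
  by rewrite rmorphD !rmorphM /= !conjCK; ring.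
have ES n : f n.+1 * (wcomp_predn_adj w g n.+1)^* =
    wcomp predn w f n.+2 * (g n.+2)^*.
  rewrite (wcomp_predn_adjE _ _ wM) !(wcomp_prednE _ _ wM) mul0r addr0.
  by rewrite rmorphM /= !conjCK; ring.
by congr (_ +i* _)%C; apply: lim_series_merge => // [|n];
  rewrite ?E0 ?ES ?raddfD.
Qed.

Lemma conj_mul_sqnorm (z : R[i]) : z^* * z = (sqnorm z)%:C%C.
Proof. by rewrite sqnormE normCKC. Qed.

Lemma wcomp_predn_adjK w M f n : (forall n, fibre_mass w n <= M) ->
  wcomp_predn_adj w (wcomp predn w f) n = (fibre_mass w n)%:C%C * f n.
Proof.
move=> wM; rewrite (wcomp_predn_adjE _ _ wM) !(wcomp_prednE _ _ wM) /=.
rewrite ![(w _)^* * _]mulrA !conj_mul_sqnorm; case: n => [|n] /=.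
  by rewrite mul1r [X in _ + X]mulrA conj_mul_sqnorm [LHS]addrC -mulrDl -rmorphD.
by rewrite !mul0r addr0.
Qed.

(** All three terms of the 2-isometry equation are multiplication operators; the
    hypotheses are the vanishing of the resulting symbol. *)
Lemma wcomp_predn_two_isometry w M : (forall n, fibre_mass w n <= M) ->
  1 - 2 * fibre_mass w 0%N +
    (sqnorm (w 0%N) * fibre_mass w 0%N + sqnorm (w 1%N) * fibre_mass w 1%N) = 0 ->
  (forall n, 1 - 2 * fibre_mass w n.+1 + fibre_mass w n.+1 * fibre_mass w n.+2 = 0) ->
  two_isometry (wcomp predn w).
Proof.
move=> wM w0 wS; exists (wcomp_predn_adj w); first exact: wcomp_predn_is_adjoint wM.
move=> f; apply: ell2_eqP => n.
set C := wcomp predn w; set A := wcomp_predn_adj w.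
rewrite -[LHS]/(f n - 2%:R * A (C f) n + A (A (C (C f))) n) -[RHS]/(0 : R[i]).
rewrite [A (A _) n](wcomp_predn_adjE _ _ wM) !(wcomp_predn_adjK _ _ wM).
rewrite !(wcomp_prednE _ _ wM).
have -> : (2%:R : R[i]) = 2%:C%C by rewrite rmorph_nat.
case: n => [|n] /=.
  transitivity ((1 - 2 * fibre_mass w 0%N + (sqnorm (w 0%N) * fibre_mass w 0%N +
                 sqnorm (w 1%N) * fibre_mass w 1%N))%:C%C * f 0%N); last by rewrite w0 mul0r.
  have := conj_mul_sqnorm (w 0%N); have := conj_mul_sqnorm (w 1%N).
  move: (sqnorm (w 1%N)) (sqnorm (w 0%N)) (fibre_mass w 0%N) (fibre_mass w 1%N).
  move=> s1 s0 r0 r1 E1 E0.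
  by rewrite !(rmorphD, rmorphN, rmorphM, rmorph1) /= -E0 -E1; ring.
transitivity ((1 - 2 * fibre_mass w n.+1 +
               fibre_mass w n.+1 * fibre_mass w n.+2)%:C%C * f n.+1); last first.
  by rewrite wS mul0r.
have : (w n.+2)^* * w n.+2 = (fibre_mass w n.+1)%:C%C by exact: conj_mul_sqnorm.
move: (fibre_mass w n.+1) (fibre_mass w n.+2) => r1 r2 E1.
by rewrite !(rmorphD, rmorphN, rmorphM, rmorph1) /= -E1; ring.
Qed.

(** [(T^* T)^-1] multiplies the coordinate [n] by [(fibre_mass w n)^-1], and [T]
    moves this factor to the fibre over [n]. *)
Definition cauchy_dual_weight w n : R[i] := w n / (fibre_mass w n.-1)%:C%C.

Lemma sqnorm_cauchy_dual_weight w n :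
  sqnorm (cauchy_dual_weight w n) = sqnorm (w n) / fibre_mass w n.-1 ^+ 2.
Proof. by rewrite sqnormM -fmorphV sqnorm_real exprVn. Qed.

Lemma fibre_mass_cauchy_dual w n : 0 < fibre_mass w n ->
  fibre_mass (cauchy_dual_weight w) n = (fibre_mass w n)^-1.
Proof.
case: n => [|n] w0; rewrite {1}/fibre_mass !sqnorm_cauchy_dual_weight /=.
  by rewrite -mulrDl -[_ + _]/(fibre_mass w 0%N) expr2 invfM mulrA divff ?mul1r ?lt0r_neq0.
by rewrite -[sqnorm _]/(fibre_mass w n.+1) expr2 invfM mulrA divff ?mul1r ?lt0r_neq0.
Qed.

Lemma fibre_mass_cauchy_dual_le w : (forall n, 1 <= fibre_mass w n) ->
  forall n, fibre_mass (cauchy_dual_weight w) n <= 1.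
Proof.
move=> w1 n; have w0 : 0 < fibre_mass w n by exact: lt_le_trans (w1 n).
by rewrite fibre_mass_cauchy_dual// invf_le1.
Qed.

Lemma wcomp_predn_cauchy_dual w M : (forall n, 1 <= fibre_mass w n <= M) ->
  is_cauchy_dual (wcomp predn w) (wcomp predn (cauchy_dual_weight w)).
Proof.
move=> w1M; have wM n : fibre_mass w n <= M by have /andP[] := w1M n.
have w1 n : 1 <= fibre_mass w n by have /andP[] := w1M n.
have w0 n : 0 < fibre_mass w n by exact: lt_le_trans (w1 n).
split; first exact: wcomp_predn_expansive w1M.
pose B : ell2 R -> ell2 R := wcomp id (fun n => (fibre_mass w n)^-1%:C%C).
have BE f n : B f n = (fibre_mass w n)^-1%:C%C * f n.
  apply: wcompE; rewrite (@wcomp_dom_le _ _ 1)// => [{}n|g].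
    by rewrite sqnorm_real; apply: exprn_ile1; rewrite ?invr_ge0 ?invf_le1// ltW.
  exact: ell2P.
exists (wcomp_predn_adj w), B; split.
- exact: wcomp_predn_is_adjoint wM.
- move=> f; apply: ell2_eqP => n; rewrite BE (wcomp_predn_adjK _ _ wM).
  by rewrite mulrA -rmorphM mulVf ?lt0r_neq0// mul1r.
- move=> f; apply: ell2_eqP => n.
  rewrite -[LHS]/(wcomp_predn_adj w (wcomp predn w (B f)) n).
  rewrite (wcomp_predn_adjK _ _ wM) BE.
  by rewrite mulrA -rmorphM divff ?lt0r_neq0// mul1r.
- move=> f; apply: ell2_eqP => n; rewrite (wcomp_prednE _ _ wM) BE.
  by rewrite (wcomp_prednE _ _ (fibre_mass_cauchy_dual_le w1)) fmorphV mulrA.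
Qed.

Lemma wcomp_predn_basis0 w M : (forall n, fibre_mass w n <= M) ->
  wcomp predn w (basis 0) = w 0%N *: basis 0 + w 1%N *: basis 1.
Proof.
move=> wM; apply: ell2_eqP => n; rewrite (wcomp_prednE _ _ wM) ell2DE !ell2ZE !basisE.
by case: n => [|[|n]]; rewrite /= ?(mulr1, mulr0, addr0, add0r).
Qed.

Lemma wcomp_predn_basisS w M k : (forall n, fibre_mass w n <= M) ->
  wcomp predn w (basis k.+1) = w k.+2 *: basis k.+2.
Proof.
move=> wM; apply: ell2_eqP => n; rewrite (wcomp_prednE _ _ wM) ell2ZE !basisE.
by case: n => [|n]; rewrite /= ?mulr0// eqSS; case: eqP => [->|]; rewrite ?mulr0.
Qed.

(** The vector is [basis 0]: [T (basis 0)] involves [basis 1], and [T] shifts the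
    later basis vectors, so the span of the orbit contains every finite sum. *)
Lemma wcomp_predn_cyclic w M : (forall n, fibre_mass w n <= M) ->
  (forall n, w n.+1 != 0) -> cyclic_operator (wcomp predn w).
Proof.
move=> wM w0; set T := wcomp predn w.
have Tlin : linear T by have [] := wcomp_predn_bounded wM.
exists (basis 0); set S := (X in dense X).
have TD f g : T (f + g) = T f + T g by have := Tlin 1 f g; rewrite !scale1r.
have TZ a f : T (a *: f) = a *: T f := scalable_linear Tlin a f.
have S_lin a f g : S f -> S g -> S (a *: f + g).
  move=> [d1 [a1 ->]] [d2 [a2 ->]].
  exists (d1 + d2)%N, (fun n => a * (if (n < d1)%N then a1 n else 0) +
                            (if (n < d2)%N then a2 n else 0)).
  have ext d d' (b : nat -> R[i]) : \sum_(n < d) b n *: iter n T (basis 0) =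
      \sum_(n < d + d') (if (n < d)%N then b n else 0) *: iter n T (basis 0).
    rewrite big_split_ord /= [X in _ + X]big1 ?addr0 => [|i _]; last first.
      by rewrite ltnNge leq_addr scale0r.
    by apply: eq_bigr => i _; rewrite ltn_ord.
  rewrite (ext d1 d2) (ext d2 d1) [(d2 + d1)%N]addnC scaler_sumr -big_split /=.
  by apply: eq_bigr => i _; rewrite scalerA scalerDl.
have S0 : S 0 by exists 0%N, (fun=> 0); rewrite big_ord0.
have SZ a f : S f -> S (a *: f) by move=> Sf; rewrite -[_ *: f]addr0; exact: S_lin.
have ST f : S f -> S (T f).
  move=> [d [a ->]]; exists d.+1, (fun n => if n is m.+1 then a m else 0).
  rewrite big_ord_recl scale0r add0r.
  have T0 : T 0 = 0 by have := TZ 0 0; rewrite !scale0r.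
  elim: d => [|d IH]; first by rewrite !big_ord0.
  by rewrite big_ord_recr [RHS]big_ord_recr TD TZ IH.
have Sb k : S (basis k).
  have S1 : S (basis 0) by exists 1%N, (fun=> 1); rewrite big_ord1 scale1r.
  elim: k => // -[_|k IH].
    have -> : basis 1 = (w 1%N)^-1 *: (- w 0%N *: basis 0 + T (basis 0)).
      rewrite /T (wcomp_predn_basis0 wM) addrA -scalerDl addNr scale0r add0r.
      by rewrite scalerA mulVf// scale1r.
    by apply/SZ/S_lin => //; exact: ST.
  have -> : basis k.+2 = (w k.+2)^-1 *: T (basis k.+1).
    by rewrite /T (wcomp_predn_basisS _ wM) scalerA mulVf// scale1r.
  exact/SZ/ST.
have Ssum f N : S (\sum_(n < N) f n *: basis n).
  elim: N => [|N IH]; first by rewrite big_ord0.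
  have -> : \sum_(n < N.+1) f n *: basis n = f N *: basis N + \sum_(n < N) f n *: basis n.
    by rewrite big_ord_recr addrC.
  exact: S_lin.
move=> O [f Of] oO.
have /nbhs_ballP[e /= e0 eO] : nbhs f O by exact: open_nbhs_nbhs.
have eE : e = (complex.Re e)%:C%C by rewrite complex.RRe_real// gtr0_real.
have [|N fN] := @ell2_finite_approx R f (complex.Re e); first by rewrite -ltcR -eE.
exists (\sum_(n < N) f n *: basis n); split; last exact: Ssum.
by apply: eO; rewrite -ball_normE /= eE.
Qed.

(** [T (basis 0) = w 0 *: basis 0 + w 1 *: basis 1], and the [n]-th iterates of
    the two summands are orthogonal: the first vanishes beyond [n], the second
    is a multiple of [basis n.+1]. *)
Lemma wcomp_predn_moments w M n : (forall n, fibre_mass w n <= M) ->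
  `|iter n.+1 (wcomp predn w) (basis 0)| ^+ 2 =
  (sqnorm (w 0%N))%:C%C * `|iter n (wcomp predn w) (basis 0)| ^+ 2 +
  (sqnorm (w 1%N) * \prod_(i < n) sqnorm (w i.+2))%:C%C.
Proof.
move=> wM; set T := wcomp predn w.
have Tlin : linear T by have [] := wcomp_predn_bounded wM.
have TZ a f : T (a *: f) = a *: T f := scalable_linear Tlin a f.
have TnD k a b f g : iter k T (a *: f + b *: g) = a *: iter k T f + b *: iter k T g.
  by elim: k => // k IH; rewrite !iterS IH Tlin TZ.
have Tn1 k : iter k T (basis 1) = (\prod_(i < k) w i.+2) *: basis k.+1.
  elim: k => [|k IH]; first by rewrite big_ord0 scale1r.
  by rewrite iterS IH TZ big_ord_recr /= -scalerA -(wcomp_predn_basisS _ wM).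
have supp k j : (k < j)%N -> iter k T (basis 0) j = 0.
  elim: k j => [|k IH] [|j] //; rewrite ltnS => kj.
  by rewrite iterS {1}/T (wcomp_prednE _ _ wM) IH ?mulr0.
rewrite iterSr {2}/T (wcomp_predn_basis0 wM) TnD Tn1 scalerA ell2_pythagoras ?supp//.
rewrite sqnormE; congr (_ + _); rewrite normrM exprMn rmorphM /= sqnormE; congr (_ * _).
rewrite normr_prod -prodrXl rmorph_prod /=; apply: eq_bigr => i _.
by rewrite sqnormE.
Qed.

End predn_weights.

(** * The weights of the theorem *)

Section the_weight.
Context {R : realType}.
Implicit Types (x : R) (n : nat).

Let d_gt0 x n : 0 < x -> 0 < 1 + n%:R * x.
Proof. by move=> x0; rewrite ltr_wpDr// mulr_ge0// ltW. Qed.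

Lemma sqnorm_weight0 x : sqnorm (weight x 0) = 1 / 2.
Proof. by rewrite /weight sqnorm_real exprMn expr1n exprVn sqr_sqrtr. Qed.

Lemma sqnorm_weight1 x : 0 < x -> sqnorm (weight x 1) = 1 / 2 + x.
Proof.
by move=> x0; rewrite /weight sqnorm_real sqr_sqrtr// addr_ge0 ?divr_ge0// ltW.
Qed.

(** Writing [y] for the excess of the squared weight at 2 over 1, one has
    [y = x / (1 + 2 * x)], hence [1 + n%:R * y = (1 + n.+2%:R * x) / (1 + 2 * x)]
    and the common denominator cancels in every [xi]. *)
Lemma sqnorm_weightSS x n : 0 < x ->
  sqnorm (weight x n.+2) = (1 + n.+3%:R * x) / (1 + n.+2%:R * x).
Proof.
move=> x0; have d2 : 0 < 1 + 2 * x := d_gt0 2 x0.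
have w2E : Num.sqrt ((1 + 3 * x) / (1 + 2 * x)) ^+ 2 = (1 + 3 * x) / (1 + 2 * x).
  by rewrite sqr_sqrtr// divr_ge0// ltW//; exact: (d_gt0 3).
case: n => [|n]; rewrite /weight sqnorm_real ?w2E// /xi w2E.
have dE k : 1 + k%:R * ((1 + 3 * x) / (1 + 2 * x) - 1) =
    (1 + k.+2%:R * x) / (1 + 2 * x).
  by rewrite -!natr1; field; exact: lt0r_neq0.
rewrite sqr_sqrtr !dE; last by rewrite !divr_ge0// ltW// d_gt0.
by rewrite invfM invrK mulrACA mulVf ?mulr1// lt0r_neq0.
Qed.

Lemma fibre_mass_weight0 x : 0 < x -> fibre_mass (weight x) 0 = 1 + x.
Proof.
by move=> x0; rewrite /fibre_mass sqnorm_weight0 sqnorm_weight1//; field.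
Qed.

Lemma fibre_mass_weightS x n : 0 < x ->
  fibre_mass (weight x) n.+1 = (1 + n.+3%:R * x) / (1 + n.+2%:R * x).
Proof. exact: sqnorm_weightSS. Qed.

Lemma fibre_mass_weight_bounds x n : 0 < x ->
  1 <= fibre_mass (weight x) n <= 1 + x.
Proof.
move=> x0; case: n => [|n]; first by rewrite fibre_mass_weight0// lexx lerDl ltW.
rewrite fibre_mass_weightS// ler_pdivlMr ?ler_pdivrMr ?d_gt0//.
have := mulr_ge0 (ltW x0) (mulr_ge0 (ler0n R n.+2) (ltW x0)).
rewrite -[n.+3%:R]natr1; move: (n.+2%:R : R) => t t0.
by apply/andP; split; lra.
Qed.

Lemma weight_neq0 x n : 0 < x -> weight x n.+1 != 0.
Proof.
move=> x0; suff : 0 < sqnorm (weight x n.+1).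
  by apply: contraTneq => ->; rewrite /sqnorm /= expr0n addr0 ltxx.
case: n => [|n]; first by rewrite sqnorm_weight1//; lra.
by rewrite sqnorm_weightSS// divr_gt0 ?d_gt0.
Qed.

Lemma weight_two_isometry x : 0 < x -> two_isometry (wcomp predn (weight x)).
Proof.
move=> x0; have wM n : fibre_mass (weight x) n <= 1 + x.
  by have /andP[] := fibre_mass_weight_bounds n x0.
apply: (wcomp_predn_two_isometry wM) => [|n].
- rewrite fibre_mass_weight0// fibre_mass_weightS// sqnorm_weight0 sqnorm_weight1//.
  by field; exact: lt0r_neq0 (d_gt0 2 x0).
- rewrite !fibre_mass_weightS//.
  have := lt0r_neq0 (d_gt0 n.+2 x0); have := lt0r_neq0 (d_gt0 n.+3 x0).
  rewrite -[n.+4%:R]natr1 -[n.+3%:R]natr1; move: (n.+2%:R : R) => t h2 h3.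
  by field; rewrite h2 h3.
Qed.

(** The weights of the Cauchy dual satisfy
    [\prod_(i < n) sqnorm (v i.+2) = (1 + 2 * x) / (1 + n.+2%:R * x)], whence the
    inverse-linear inhomogeneous term in the recursion for the moments. *)
Lemma weight_cauchy_dual_not_subnormal x : 0 < x ->
  ~ subnormal (wcomp predn (cauchy_dual_weight (weight x))).
Proof.
move=> x0 sn; set v := cauchy_dual_weight (weight x) in sn *.
have w1 n : 1 <= fibre_mass (weight x) n.
  by have /andP[] := fibre_mass_weight_bounds n x0.
pose m j := complex.Re (`|iter j (wcomp predn v) (basis 0)| ^+ 2).
have mE j : `|iter j (wcomp predn v) (basis 0)| ^+ 2 = (m j)%:C%C.
  by rewrite /m complex.RRe_real// ger0_real// exprn_ge0.
pose c := (1 + 2 * x) / x.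
have c0 : 0 < c by rewrite divr_gt0 ?(d_gt0 2).
have prodE n : \prod_(i < n) sqnorm (v i.+2) = c / (c + n%:R).
  have -> : c / (c + n%:R) = (1 + 2 * x) / (1 + n.+2%:R * x).
    have := lt0r_neq0 (d_gt0 n.+2 x0); rewrite -!natr1 /c.
    move: (n%:R : R) => t h; field.
    by rewrite h lt0r_neq0.
  elim: n => [|n IH]; first by rewrite big_ord0 divff// lt0r_neq0// (d_gt0 2).
  rewrite big_ord_recr /= IH.
  rewrite -[sqnorm _]/(fibre_mass v n.+1) fibre_mass_cauchy_dual; last first.
    exact: lt_le_trans (w1 _).
  by rewrite fibre_mass_weightS// invf_div mulrA divfK// lt0r_neq0// d_gt0.
pose q := 1 / 2 / (1 + x) ^+ 2.
pose k := (1 / 2 + x) / (1 + x) ^+ 2 * c.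
have mS j : m j.+1 = q * m j + k / (c + j%:R).
  have := wcomp_predn_moments j (fibre_mass_cauchy_dual_le w1).
  rewrite -/v !mE -rmorphM -rmorphD => E.
 have {E} -> := complexI E.
  rewrite prodE !sqnorm_cauchy_dual_weight.
  by rewrite sqnorm_weight0 sqnorm_weight1// fibre_mass_weight0// mulrA.
have x1 : 1 < (1 + x) ^+ 2 by rewrite exprn_egt1//; lra.
have q01 : 0 < q < 1.
  by rewrite /q divr_gt0 ?ltr_pdivrMr//=; lra.
have k0 : 0 < k by rewrite mulr_gt0// divr_gt0//; lra.
have [n] := bdiff_even_neg q01 k0 c0 mS.
by rewrite ltNge (subnormal_bdiff_ge0 sn mE).
Qed.

End the_weight.

Theorem theorem4p4 (R : realType) :
  exists2 eps : R, 0 < eps &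
    forall x : R, 0 < x < eps ->
      let C : ell2 R -> ell2 R := wcomp predn (weight x) in
      [/\ wcomp_dom predn (weight x) = setT,
          bounded_operator C,
          cyclic_operator C,
          two_isometry C &
          exists2 C' : ell2 R -> ell2 R, is_cauchy_dual C C' & ~ subnormal C'].
Proof.
exists 1 => // x /andP[x0 _] C.
have w1M n := fibre_mass_weight_bounds n x0.
have wM n : fibre_mass (weight x) n <= 1 + x by have /andP[] := w1M n.
split.
- exact: wcomp_predn_dom wM.
- exact: wcomp_predn_bounded wM.
- by apply: (wcomp_predn_cyclic wM) => n; exact: weight_neq0.
- exact: weight_two_isometry.
- eexists; first exact: wcomp_predn_cauchy_dual w1M.
  exact: weight_cauchy_dual_not_subnormal.
Qed.
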